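(* Let $k\ge 3$ be an odd integer. A simple, connected, finite graph $G$ exhibits a $k$-periodic Grover walk if and only if $G$ is the cycle graph $C_k$ on $k$ vertices.
   Context: For a simple connected finite graph $G=(V,E)$, let $\mathcal{A}=\{(u,v),(v,u)\mid uv\in E\}$ be the set of arcs; for an arc $e=(u,v)$ write $o(e)=u$, $t(e)=v$, and $\bar e=(v,u)$. The Grover walk on $G$ has time evolution $U$ on $\mathbb{C}^{\mathcal{A}}$ with entries $U_{e,f}=2/\deg t(f)$ if $t(f)=o(e)$ and $e\neq\bar f$; $U_{e,f}=2/\deg t(f)-1$ if $e=\bar f$; and $U_{e,f}=0$ otherwise. $G$ is periodic if $U^m=I$ for some positive integer $m$; the least such $m$ is the period, and $G$ is called $k$-periodic if its period is $k$. *)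

(* Defs.v *)
From HB Require Import structures.
From mathcomp Require Import all_boot all_order all_algebra.
Set Implicit Arguments. Unset Strict Implicit. Unset Printing Implicit Defensive.
Import Order.TTheory GRing.Theory Num.Theory.
Local Open Scope ring_scope.

Definition simple_graph (T : finType) (g : rel T) : Prop :=
  symmetric g /\ irreflexive g.

Definition connected_graph (T : finType) (g : rel T) : Prop :=
  forall x y : T, connect g x y.

Definition arc (T : finType) (g : rel T) : predArgType :=
  {a : T * T | g a.1 a.2}.

Definition o_arc (T : finType) (g : rel T) (a : arc g) : T := (val a).1.
Definition t_arc (T : finType) (g : rel T) (a : arc g) : T := (val a).2.

Definition deg (T : finType) (g : rel T) (v : T) : nat := #|[set w | g v w]|.

Definition grover_entry (T : finType) (g : rel T) (e f : arc g) : rat :=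
  if t_arc f == o_arc e then
    if (o_arc e == t_arc f) && (t_arc e == o_arc f)
    then 2 / (deg g (t_arc f))%:R - 1
    else 2 / (deg g (t_arc f))%:R
  else 0.

Definition grover (T : finType) (g : rel T) : 'M[rat]_#|arc g| :=
  \matrix_(i, j) grover_entry (enum_val i) (enum_val j).

Definition k_periodic (T : finType) (g : rel T) (k : nat) : Prop :=
  (0 < k)%N /\ grover g ^+ k = 1%:M /\
  forall m : nat, (0 < m < k)%N -> grover g ^+ m <> 1%:M.

Definition is_cycle_graph (T : finType) (g : rel T) (k : nat) : Prop :=
  exists f : T -> 'I_k, bijective f /\
    forall x y : T, g x y = ((val (f y) == ((f x).+1 %% k)%N) || (val (f x) == ((f y).+1 %% k)%N)).

(* Main.v *)
Require Import Defs.
From mathcomp Require Import all_boot all_order all_algebra.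
From mathcomp Require Import zify ring.
Set Implicit Arguments. Unset Strict Implicit. Unset Printing Implicit Defensive.
Import Order.TTheory GRing.Theory Num.Theory.
Local Open Scope ring_scope.
Import Defs.

(* Let U be the evolution operator, N the number of arcs, n the number of vertices,
   M the number of edges, and suppose U^k = 1 with k odd.  Let K be the arc-vertex
   matrix of terminal vertices, S the arc reversal, and L_s (s = 1 or -1) the
   arc-edge matrix with L_s L_s^T = 1 + s S.  With X_s = [K | L_s] and
   D = diag(2/deg, -1) one has U - s = S X_s D X_s^T.

   The case s = -1: 1 + U is invertible, hence M <= n; since (1 + U) K =
   L_1 L_1^T K and K has full rank, n <= M.  So M = n and X_s is square.
   The case s = 1: X_1 has a one-dimensional kernel by connectedness, so the
   eigenvalue 1 of U has multiplicity at most 2.  The other eigenvalues z are k-th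
   roots of unity of odd order > 1, for which the 1 + z are algebraic units, so
   |det (1 + U)| <= 2^2.  On the other hand X_(-1) is an integer matrix with even
   row sums, so its determinant is even, and
   |det (1 + U)| = (det X_(-1))^2 2^n / prod deg >= 4 2^n / prod deg.
   Hence prod deg >= 2^n while sum deg = N = 2 n, and the equality case of the
   AM-GM inequality makes the graph 2-regular, i.e. a cycle.  On a 2-regular graph
   U is the permutation matrix moving each arc to the next one, so the period of
   a cycle is its length. *)

(** * Determinants over the rationals and the integers *)

(** Sylvester's identity: eliminate either off-diagonal block of the same block matrix. *)
Lemma det_shift_mulmxC (F : fieldType) (m n : nat) (c : F)
    (A : 'M[F]_(m, n)) (B : 'M[F]_(n, m)) : c != 0 ->
  c ^+ n * \det (c%:M + A *m B) = c ^+ m * \det (c%:M + B *m A).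
Proof.
move=> c0.
pose M := block_mx (c%:M : 'M[F]_m) (- A) B (1%:M : 'M_n).
have e1 : block_mx 1%:M A 0 1%:M *m M = block_mx (c%:M + A *m B) 0 B 1%:M.
  by rewrite mulmx_block !mul1mx !mul0mx !mulmx1 addNr !add0r.
have e2 : block_mx 1%:M 0 (- B) c%:M *m M = block_mx c%:M (- A) 0 (c%:M + B *m A).
  rewrite mulmx_block !mul1mx !mul0mx !mulmx1 !addr0 mulmxN !mulNmx opprK.
  by rewrite scalar_mxC addNr addrC.
have d1 : \det M = \det (c%:M + A *m B).
  have := congr1 determinant e1; rewrite det_mulmx det_ublock det_lblock.
  by rewrite !det_scalar !expr1n !mul1r mulr1.
have := congr1 determinant e2; rewrite det_mulmx det_ublock det_lblock.
by rewrite !det_scalar expr1n mul1r d1.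
Qed.

(* The characteristic polynomial of V divides a power of 1 + X + ... + X^(k-1)
   over the integers (Gauss), and the latter takes the value 1 at -1 since k is odd. *)
Lemma det_1D_unit_of_geom (r k : nat) (V : 'M[rat]_r) :
  odd k -> \sum_(j < k) V ^+ j = 0 -> `|\det (1%:M + V)| = 1.
Proof.
move=> ok sV.
pose psi : {poly int} := \sum_(j < k) 'X^j.
have dv : char_poly V %| map_poly intr (psi ^+ r).
  (* X - V divides each X^j - V^j, and the V^j sum to zero; determinants then give psi^r = char_poly
     V * det Q. *)
  have [Q eQ] : exists Q : 'M[{poly rat}]_r,
    (map_poly intr psi)%:M = char_poly_mx V *m Q.
    pose W : 'M[{poly rat}]_r := map_mx polyC V.
    exists (\sum_(j < k) \sum_(i < j) 'X%:M ^+ (j.-1 - i) *m W ^+ i).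
    have -> : (map_poly intr psi : {poly rat})%:M =
        \sum_(j < k) (('X%:M : 'M[{poly rat}]_r) ^+ j - W ^+ j).
      rewrite sumrB.
      have -> : \sum_(j < k) W ^+ j = 0.
        have -> : \sum_(j < k) W ^+ j = map_mx polyC (\sum_(j < k) V ^+ j).
          rewrite raddf_sum; apply: eq_bigr => j _.
          rewrite /W; elim: (j : nat) => [|i IH]; first by rewrite !expr0; exact/esym/map_mx1.
          by rewrite !exprS IH; exact/esym/map_mxM.
        by rewrite sV raddf0.
      rewrite subr0 rmorph_sum raddf_sum; apply: eq_bigr => j _ /=.
      rewrite map_polyXn; elim: (j : nat) => [|i IH]; first by rewrite !expr0.
      by rewrite !exprS -IH; exact: scalar_mxM.
    rewrite mulmx_sumr; apply: eq_bigr => j _.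
    by apply: subrXX_comm; exact/esym/scalar_mxC.
  have := congr1 determinant eQ; rewrite det_mulmx det_scalar rmorphXn /= => ->.
  exact: dvdp_mulr.
have [p1 [a a0 pE] [q qE]] := dvdpP_rat_int dv.
have p1N : p1.[-1] * q.[-1] = 1.
  rewrite -hornerM -qE horner_exp /psi horner_sum.
  have -> : \sum_(i < k) ('X^i).[-1 : int] = 1.
    have altsum m : \sum_(i < m.*2.+1) ('X^i).[-1 : int] = 1.
      elim: m => [|m IH]; first by rewrite big_ord1 hornerXn.
      by rewrite doubleS big_ord_recr big_ord_recr /= IH !hornerXn !exprS !mulN1r -addrA addrN addr0.
    by rewrite -(odd_double_half k) ok altsum.
  by rewrite expr1n.
have lc : lead_coef p1 * lead_coef q = 1.
  rewrite -lead_coefM -qE; apply/monicP; apply: monic_exp; apply/monicP.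
  have -> : psi = \poly_(j < k) 1 by rewrite poly_def; apply: eq_bigr => j _; rewrite scale1r.
  by case: (k) ok => // k' _; rewrite lead_coef_poly ?oner_eq0.
have unitZ (x y : int) : x * y = 1 -> `|x%:~R| = 1 :> rat.
  move=> xy; have := congr1 absz xy; rewrite abszM => /eqP; rewrite muln_eq1.
  by case/andP=> /eqP x1 _; rewrite -intr_norm -abszE x1.
(* Both psi^r and [char_poly V] are monic, so the rational factor [a] is a sign. *)
have na : `|a| = 1.
  have /monicP := char_poly_monic V.
  rewrite pE lead_coefZ lead_coef_map_inj //; last exact: intr_inj.
  move/(congr1 Num.norm); rewrite normrM (unitZ _ _ lc) mulr1 normr1 //.
have : `|(char_poly V).[-1]| = 1.
  rewrite pE hornerZ normrM na mul1r.
  by rewrite -[X in _.[X]](rmorphN1 intr) horner_map (unitZ _ _ p1N).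
rewrite /char_poly -horner_evalE -det_map_mx.
have -> : map_mx (horner_eval (-1)) (char_poly_mx V) = (-1) *: (1%:M + V).
  apply/matrixP => i j; rewrite !mxE /horner_eval !hornerE hornerMn hornerX; ring.
by rewrite detZ normrM normrX normrN1 expr1n mul1r.
Qed.

(* With U - 1 = A W a full-rank factorization, V = 1 + W A is the action of U on
   the image of U - 1, where the geometric sum vanishes. *)
Lemma det_1D_odd_order (n k : nat) (U : 'M[rat]_n) :
  odd k -> U ^+ k = 1%:M -> `|\det (1%:M + U)| = 2 ^+ (n - \rank (U - 1%:M)).
Proof.
move=> ok Uk; have r_le := rank_leq_row (U - 1%:M).
have : exists A : 'M_(n, \rank (U - 1%:M)), exists W : 'M_(_, n),
    [/\ A *m W = U - 1%:M, row_free W & row_full A].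
  exists (col_base (U - 1%:M)), (row_base (U - 1%:M)).
  by split; rewrite ?mulmx_base ?row_base_free ?col_base_full.
move: (\rank _) r_le => r r_le [A [W [AW fW fA]]].
pose V := 1%:M + W *m A.
have VW : V *m W = W *m U.
  by rewrite mulmxDl mul1mx -mulmxA AW mulmxBr mulmx1 addrC subrK.
have VWX j : V ^+ j *m W = W *m U ^+ j.
  elim: j => [|j IH]; first by rewrite !expr0 mul1mx mulmx1.
  rewrite exprSr exprS.
  by rewrite -[V ^+ j * V]/(V ^+ j *m V) -[U * U ^+ j]/(U *m U ^+ j) -mulmxA VW !mulmxA IH -!mulmxA -[U ^+ j *m U]/(U ^+ j * U) -exprSr exprS.
(* Multiplication by W on the right and by A on the left is injective; this reduces the claim to (U
   - 1) * (sum of U^j) = U^k - 1 = 0. *)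
have sV : \sum_(j < k) V ^+ j = 0.
  apply: (row_free_inj fW).
  rewrite mul0mx mulmx_suml; under eq_bigr do rewrite VWX.
  rewrite -mulmx_sumr.
  apply: (@row_full_inj _ _ _ _ A) => //.
  rewrite mulmx0 mulmxA AW.
  have -> : (U - 1%:M) *m \sum_(i < k) U ^+ i = U ^+ k - 1.
    by rewrite subrX1.
  by rewrite Uk subrr.
have det_V := det_1D_unit_of_geom ok sV.
have two0 : (2 : rat) != 0 by [].
(* For c = 2 the two shifted products are 2 + A W = 1 + U and 2 + W A = 1 + V. *)
have := det_shift_mulmxC A W two0.
have -> : 2%:M + A *m W = 1%:M + U.
  by rewrite AW addrCA addrC (_ : 2%:M = 1%:M + 1%:M) ?addrK ?addrA // -raddfD.
have -> : 2%:M + W *m A = 1%:M + V.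
  by rewrite /V addrA -raddfD.
move/(congr1 Num.norm); rewrite !normrM det_V mulr1 !normrX normr_nat.
move: `|\det _| => x; rewrite -{1}(subnKC r_le) exprD; apply: mulfI.
by rewrite expf_neq0.
Qed.

(** Apply adj X * X = det X to the all-ones vector: det X is an integer combination of the row
    sums. *)
Lemma dvdz_det_row_sums (n : nat) (d : int) (X : 'M[int]_n) :
  (0 < n)%N -> (forall i, d %| \sum_j X i j)%Z -> (d %| \det X)%Z.
Proof.
case: n X => // n X _ dvX.
have -> : \det X = (\adj X *m X *m const_mx 1 : 'cV_n.+1) 0 0.
  by rewrite mul_adj_mx mul_scalar_mx !mxE mulr1.
rewrite -mulmxA mxE; apply: rpred_sum => i _; apply: dvdz_mull.
by rewrite mxE; under eq_bigr do rewrite mxE mulr1; apply: dvX.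
Qed.

(** det X is even and nonzero, so its square is at least 4. The equation [m = n] is a hypothesis
    because the two sizes of [incz] agree only after a counting argument. *)
Lemma det_congruence_ge (m n : nat) (X : 'M[int]_(m, n)) (D : 'M[rat]_n) :
  m = n -> (0 < m)%N -> (forall i, 2 %| \sum_j X i j)%Z ->
  \det (map_mx intr X *m D *m (map_mx intr X)^T) != 0 ->
  4 * `|\det D| <= `|\det (map_mx intr X *m D *m (map_mx intr X)^T)|.
Proof.
move=> e; case: n / e X D => X D m0 dvX.
have /dvdzP[z zE] := dvdz_det_row_sums m0 dvX.
rewrite !det_mulmx det_tr det_map_mx /= zE => nz.
have z0 : z != 0 by apply: contraNneq nz => ->; rewrite !mul0r.
rewrite mulrAC normrM ler_wpM2r // -expr2 normrX rmorphM normrM exprMn.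
rewrite normr_nat -[leLHS]mul1r (_ : 4 = 2 ^+ 2) // ler_wpM2r ?sqr_ge0 //.
rewrite -(expr1n _ 2) lerXn2r ?nnegrE // -intr_norm ler1z.
by rewrite -gtz0_ge1 normr_gt0.
Qed.

(** * The factorization of U - s *)

Section GroverFactor.
Variables (T : finType) (g : rel T).
Hypotheses (gS : symmetric g) (gI : irreflexive g).

Lemma rev_arc_subproof (a : arc g) : g (t_arc a, o_arc a).1 (t_arc a, o_arc a).2.
Proof. by rewrite /= gS; apply: (valP a). Qed.

Definition rev_arc (a : arc g) : arc g := Sub (t_arc a, o_arc a) (rev_arc_subproof a).

Lemma o_rev a : o_arc (rev_arc a) = t_arc a. Proof. by []. Qed.
Lemma t_rev a : t_arc (rev_arc a) = o_arc a. Proof. by []. Qed.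

Lemma arc_eqE (a b : arc g) : (a == b) = (o_arc a == o_arc b) && (t_arc a == t_arc b).
Proof. by rewrite -val_eqE /= -pair_eqE. Qed.

Lemma rev_arcK : involutive rev_arc.
Proof. by move=> a; apply/eqP; rewrite arc_eqE !eqxx. Qed.

Lemma arc_adj (a : arc g) : g (o_arc a) (t_arc a).
Proof. exact: (valP a). Qed.

Lemma arc_neq (a : arc g) : o_arc a != t_arc a.
Proof. by apply: contraTneq (arc_adj a) => ->; rewrite gI. Qed.

Lemma rev_arc_neq (a : arc g) : rev_arc a != a.
Proof. by rewrite arc_eqE o_rev eq_sym (negPf (arc_neq a)). Qed.

(** One arc per edge, so that [#|pos_arc|] is the number M of edges. *)
Definition pos_arc : {set arc g} :=
  [set a | (enum_rank (o_arc a) < enum_rank (t_arc a))%N].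

Lemma pos_rev a : (rev_arc a \in pos_arc) = (a \notin pos_arc).
Proof.
rewrite !inE o_rev t_rev -leqNgt ltn_neqAle -[RHS]andTb; congr (_ && _).
by rewrite (inj_eq val_inj) (inj_eq enum_rank_inj) eq_sym arc_neq.
Qed.

Lemma card_arc : #|arc g| = (#|pos_arc| + #|pos_arc|)%N.
Proof.
rewrite -(cardsC pos_arc); congr addn.
rewrite -(card_imset pos_arc (can_inj rev_arcK)); apply: eq_card => a.
apply/idP/imsetP => [|[b bP ->]]; rewrite in_setC -pos_rev ?rev_arcK // => aP.
by exists (rev_arc a); rewrite ?rev_arcK.
Qed.

Definition headz : 'M[int]_(#|arc g|, #|T|) :=
  \matrix_(i, v) (t_arc (enum_val i) == enum_val v)%:R.

(* For s = 1 (resp. s = -1) the columns span the symmetric (resp. antisymmetric)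
   functions on arcs; each edge is represented by its positive arc. *)
Definition edgez (s : int) : 'M[int]_(#|arc g|, #|pos_arc|) :=
  \matrix_(i, j) ((enum_val i == enum_val j)%:R +
                  s * (enum_val i == rev_arc (enum_val j))%:R).

(** This is X_s, kept over the integers for the parity of its determinant; [flip] is S and [weights]
    is D. *)
Definition incz (s : int) := row_mx headz (edgez s).

Definition flip : 'M[rat]_#|arc g| :=
  \matrix_(i, j) (enum_val i == rev_arc (enum_val j))%:R.

Definition dinv : 'M[rat]_#|T| :=
  diag_mx (\row_v (2 / (deg g (enum_val v))%:R)).

Local Notation K := (map_mx intr headz : 'M[rat]__).
Local Notation L s := (map_mx intr (edgez s) : 'M[rat]__).
Local Notation B s := (map_mx intr (incz s) : 'M[rat]__).
Definition weights : 'M[rat]_(#|T| + #|pos_arc|) :=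
  block_mx dinv 0 0 (- 1%:M).

Lemma flip_mulE p (M : 'M[rat]_(#|arc g|, p)) i j :
  (flip *m M) i j = M (enum_rank (rev_arc (enum_val i))) j.
Proof.
rewrite mxE (bigD1 (enum_rank (rev_arc (enum_val i)))) //= !mxE enum_rankK.
rewrite rev_arcK eqxx mul1r big1 ?addr0 // => l nl.
rewrite mxE -(inv_eq rev_arcK) -[rev_arc _]enum_rankK (inj_eq enum_val_inj) eq_sym.
by rewrite (negPf nl) mul0r.
Qed.

Lemma flipK : flip *m flip = 1%:M.
Proof.
apply/matrixP => i j; rewrite flip_mulE !mxE enum_rankK (inv_eq rev_arcK) rev_arcK.
by rewrite (inj_eq enum_val_inj).
Qed.

Lemma arc_cases (a : arc g) :
  exists j, a = @enum_val _ pos_arc j \/ a = rev_arc (@enum_val _ pos_arc j).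
Proof.
case: (boolP (a \in pos_arc)) => aP.
  by exists (enum_rank_in aP a); left; rewrite enum_rankK_in.
rewrite -pos_rev in aP; exists (enum_rank_in aP (rev_arc a)); right.
by rewrite enum_rankK_in ?rev_arcK.
Qed.

Lemma pos_arc_neq_rev i j : (@enum_val _ pos_arc i == rev_arc (@enum_val _ pos_arc j)) = false.
Proof.
apply/negP => /eqP e; have := enum_valP i.
by rewrite e pos_rev (enum_valP j).
Qed.

Lemma edgez_pos s j l :
  edgez s (enum_rank (@enum_val _ pos_arc j)) l = (j == l)%:R.
Proof.
by rewrite mxE enum_rankK (inj_eq enum_val_inj) pos_arc_neq_rev mulr0 addr0.
Qed.

Lemma edgez_neg s j l :
  edgez s (enum_rank (rev_arc (@enum_val _ pos_arc j))) l = s * (j == l)%:R.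
Proof.
rewrite mxE enum_rankK (inj_eq (can_inj rev_arcK)) (inj_eq enum_val_inj).
by rewrite (inv_eq rev_arcK) pos_arc_neq_rev add0r.
Qed.

Lemma edge_gram (s : int) : s * s = 1 ->
  L s *m (L s)^T = 1%:M + s%:~R *: flip.
Proof.
move=> ss; apply/matrixP => i l.
have LE a b : L s a b = (edgez s a b)%:~R by rewrite [LHS]mxE.
have -> : (L s *m (L s)^T) i l = (\sum_j edgez s i j * edgez s l j)%:~R.
  by rewrite mxE rmorph_sum; apply: eq_bigr => j _; rewrite rmorphM /= -!LE [(_^T) _ _]mxE.
have -> : (1%:M + s%:~R *: flip) i l =
    ((enum_val l == enum_val i)%:R + s * (enum_val l == rev_arc (enum_val i))%:R)%:~R.
  rewrite mxE [X in X + _]mxE [X in _ + X]mxE [flip _ _]mxE rmorphD rmorphM /= !rmorph_nat.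
  by rewrite -(inv_eq rev_arcK) [rev_arc _ == _]eq_sym -(inj_eq enum_val_inj) [enum_val i == _]eq_sym.
congr (_%:~R); rewrite -(enum_valK i) enum_rankK.
(* A row of L_s has a single nonzero entry, 1 or s, in the column of its own edge. *)
have [j [->|->]] := arc_cases (enum_val i).
  rewrite (bigD1 j) //= big1 => [|j' nj]; rewrite edgez_pos.
    by rewrite eqxx mul1r addr0 !mxE.
  by rewrite eq_sym (negPf nj) mul0r.
rewrite (bigD1 j) //= big1 => [|j' nj]; rewrite edgez_neg.
  by rewrite eqxx mulr1 addr0 !mxE mulrDr mulrA ss mul1r rev_arcK addrC.
by rewrite eq_sym (negPf nj) mulr0 mul0r.
Qed.

Lemma head_weighted_gram i j : (K *m dinv *m K^T) i j =
  (t_arc (enum_val i) == t_arc (enum_val j))%:R * (2 / (deg g (t_arc (enum_val j)))%:R).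
Proof.
rewrite mul_mx_diag mxE (bigD1 (enum_rank (t_arc (enum_val i)))) //= big1 => [|v nv].
  rewrite !mxE enum_rankK eqxx mul1r addr0 eq_sym rmorph_nat mulrC.
  by case: eqP => [->|] //; rewrite !mul0r.
by rewrite !mxE -[t_arc _]enum_rankK (inj_eq enum_val_inj) eq_sym (negPf nv) mul0r mul0r.
Qed.

(** Reversing e turns t(f) = o(e) into equality of heads, and moves the backtracking case, with its
    -1, to the diagonal. *)
Lemma grover_flip : grover g = flip *m (K *m dinv *m K^T - 1%:M).
Proof.
apply/matrixP => i j; rewrite flip_mulE.
have subE (Z : 'M[rat]_#|arc g|) a b : (Z - 1%:M) a b = Z a b - (a == b)%:R.
  by rewrite !mxE.
rewrite subE head_weighted_gram !mxE /grover_entry enum_rankK t_rev.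
rewrite -(inj_eq enum_val_inj) enum_rankK arc_eqE o_rev t_rev.
rewrite [t_arc (enum_val j) == _]eq_sym.
by case: eqP => _; rewrite ?andbT ?andbF /= ?mul1r ?mul0r ?subr0 //; case: eqP => _ /=; rewrite ?subr0.
Qed.

Lemma incz_gram (s : int) : B s *m weights *m (B s)^T = K *m dinv *m K^T - L s *m (L s)^T.
Proof.
rewrite /incz map_row_mx mul_row_block tr_row_mx mul_row_col.
by rewrite !mulmx0 addr0 add0r mulmxN mulmx1 mulNmx.
Qed.

(** Replacing 1 by L_s L_s^T = 1 + s S in [grover_flip] subtracts s S inside, hence s S S = s
    outside. *)
Lemma grover_sub_sign (s : int) : s * s = 1 ->
  grover g - (s%:~R)%:M = flip *m (B s *m weights *m (B s)^T).
Proof.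
move=> ss; rewrite incz_gram edge_gram // grover_flip opprD addrA [RHS]mulmxDr.
by rewrite mulmxN -scalemxAr flipK scalemx1.
Qed.

End GroverFactor.

Lemma big_enum_valT (R : Type) (idx : R) (op : Monoid.com_law idx) (I : finType) (F : I -> R) :
  \big[op/idx]_(i < #|I|) F (enum_val i) = \big[op/idx]_x F x.
Proof.
rewrite [RHS](reindex (@enum_val I I)); last by exists enum_rank => i _; rewrite ?enum_valK ?enum_rankK.
by apply: eq_bigl.
Qed.

(** * Odd period forces 2-regularity *)

Section OddPeriodRegular.
Variables (T : finType) (g : rel T).
Hypotheses (gS : symmetric g) (gI : irreflexive g) (gC : connected_graph g).

Local Notation K := (map_mx intr (headz g) : 'M[rat]__).
Local Notation L s := (map_mx intr (edgez gS s) : 'M[rat]__).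
Local Notation B s := (map_mx intr (incz gS s) : 'M[rat]__).
Local Notation M := #|pos_arc g|.

Lemma card_arcs_to v : #|[set a : arc g | t_arc a == v]| = deg g v.
Proof.
rewrite -(@card_in_imset _ _ (@o_arc T g)) => [|a b]; last first.
  by rewrite !inE => /eqP ta /eqP tb oab; apply/eqP; rewrite arc_eqE oab ta tb !eqxx.
apply: eq_card => w; rewrite !inE; apply/imsetP/idP => [[a]|gvw].
  by rewrite inE => /eqP <- ->; rewrite gS arc_adj.
have gwv : g (w, v).1 (w, v).2 by rewrite /= gS.
by exists (Sub (w, v) gwv); rewrite ?inE.
Qed.

Lemma sum_deg : (\sum_v deg g v = #|arc g|)%N.
Proof.
rewrite -sum1_card (partition_big (@t_arc T g) xpredT) //=.
by apply: eq_bigr => v _; rewrite -card_arcs_to -sum1_card; apply: eq_bigl => a; rewrite inE.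
Qed.

Lemma connect_inv (R : Type) (c : T -> R) :
  (forall x y, g x y -> c x = c y) -> forall x y, c x = c y.
Proof.
move=> cg x y; have /connectP[p pP ->] := gC x y.
elim: p x pP => //= z p IH x /andP[xz /IH <-]; exact: cg.
Qed.

Lemma deg_gt0 v : (0 < #|arc g|)%N -> (0 < deg g v)%N.
Proof.
case/card_gt0P => a _; have /connectP[p pP e] := gC v (o_arc a).
case: p pP e => [_ /= <-|w p /= /andP[vw _] _]; apply/card_gt0P.
  by exists (t_arc a); rewrite inE arc_adj.
by exists w; rewrite inE.
Qed.

Lemma head_gram : K^T *m K = diag_mx (\row_v (deg g (enum_val v))%:R).
Proof.
apply/matrixP => u v; rewrite !mxE.
transitivity (\sum_(a : arc g)
   ((t_arc a == enum_val u)%:R * (t_arc a == enum_val v)%:R) : rat).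
  by rewrite -[RHS]big_enum_valT; apply: eq_bigr => i _; rewrite !mxE !rmorph_nat.
case: (altP (u =P v)) => [<-|nuv].
  rewrite mulr1n -card_arcs_to -sum1dep_card natr_sum [RHS]big_mkcond /=.
  by apply: eq_bigr => a _; case: eqP => _; rewrite ?mulr1 ?mulr0.
rewrite big1 // => a _; case: eqP => [->|_]; last by rewrite mul0r.
by rewrite (inj_eq enum_val_inj) (negPf nuv) mulr0.
Qed.

Lemma flip_unit : flip gS \in unitmx.
Proof. by case: (mulmx1_unit (flipK gS)). Qed.

Lemma det_weights : (0 < #|arc g|)%N ->
  `|\det (weights g)| = \prod_v (2 / (deg g v)%:R).
Proof.
move=> N0; rewrite /weights det_ublock normrM det_diag.
rewrite -scaleN1r detZ det1 mulr1 normrX normrN1 expr1n mulr1.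
rewrite (eq_bigr (fun v => 2 / (deg g (enum_val v))%:R)) => [|v _]; last by rewrite mxE.
rewrite (big_enum_valT _ (fun v => 2 / (deg g v)%:R)) ger0_norm //.
by apply: prodr_ge0 => v _; rewrite divr_ge0 ?ler0n.
Qed.

Lemma weights_unit : (0 < #|arc g|)%N -> weights g \in unitmx.
Proof.
move=> N0; rewrite unitmxE unitfE -normr_eq0 det_weights //.
apply/prodf_neq0 => v _; rewrite mulf_neq0 // invr_eq0 pnatr_eq0.
by rewrite -lt0n deg_gt0.
Qed.

(* A vector in the kernel is a function on vertices and edges with c(v) + d(e) = 0
   whenever v is an end of e, so by connectedness it is a multiple of (1, -1). *)
Lemma rank_incz : (0 < #|arc g|)%N -> (#|T| + M <= (\rank (B 1)).+1)%N.
Proof.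
move=> N0; pose w : 'rV[rat]_(#|T| + M) := row_mx (const_mx 1) (const_mx (-1)).
have : (kermx (B 1)^T <= w)%MS.
  apply/rV_subP => u /sub_kermxP; rewrite -[u]hsubmxK.
  move: (lsubmx u) (rsubmx u) => {u} c d.
  rewrite /incz map_row_mx tr_row_mx mul_row_col => uB.
  have cd a : c 0 (enum_rank (t_arc a)) +
       \sum_j d 0 j * (edgez gS 1 (enum_rank a) j)%:~R = 0.
    have /matrixP/(_ 0 (enum_rank a)) := uB.
    rewrite mxE [X in X + _]mxE [X in _ + X]mxE [RHS]mxE => e; rewrite -[RHS]e; congr (_ + _).
      rewrite (bigD1 (enum_rank (t_arc a))) //= big1 ?addr0 => [|v nv].
        by rewrite !mxE !enum_rankK eqxx mulr1.
      rewrite !mxE enum_rankK -[t_arc a]enum_rankK (inj_eq enum_val_inj) eq_sym.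
      by rewrite (negPf nv) mulr0.
    by apply: eq_bigr => j _; congr (_ * _); rewrite [RHS]mxE [RHS]mxE.
  have sumd j : \sum_l d 0 l * (j == l)%:R = d 0 j.
    rewrite (bigD1 j) //= eqxx mulr1 big1 ?addr0 // => l nl.
    by rewrite eq_sym (negPf nl) mulr0.
  (* The rows of the two arcs of edge j give c = - d j at both of its ends. *)
  have cdp j : c 0 (enum_rank (t_arc (@enum_val _ (pos_arc g) j))) = - d 0 j.
    apply/eqP; rewrite -addr_eq0 -(sumd j); apply/eqP.
    rewrite -[RHS](cd (enum_val j)); congr (_ + _); apply: eq_bigr => l _.
    by rewrite edgez_pos; case: (j == l).
  have cdn j : c 0 (enum_rank (o_arc (@enum_val _ (pos_arc g) j))) = - d 0 j.
    apply/eqP; rewrite -addr_eq0 -(sumd j); apply/eqP.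
    rewrite -[RHS](cd (rev_arc gS (enum_val j))); congr (_ + _); apply: eq_bigr => l _.
    by rewrite edgez_neg; case: (j == l).
  have cc : forall x y, c 0 (enum_rank x) = c 0 (enum_rank y).
    apply: connect_inv => x y gxy.
    have [j [e|e]] := arc_cases gS gI (Sub (x, y) gxy : arc g).
      by move: (cdp j) (cdn j); rewrite -e => -> ->.
    by move: (cdp j) (cdn j); rewrite -[enum_val j](rev_arcK gS) -e => -> ->.
  have [a _] := card_gt0P N0.
  have -> : row_mx c d = c 0 (enum_rank (o_arc a)) *: w.
    rewrite scale_row_mx; congr row_mx; apply/rowP => i; rewrite !mxE.
      by rewrite mulr1 -(enum_valK i); apply: cc.
    by rewrite mulrN1 -[LHS]opprK -cdp; congr (- _); apply: cc.
  exact: scalemx_sub.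
move/mxrankS; rewrite mxrank_ker mxrank_tr => le.
have := leq_trans le (rank_leq_row w); lia.
Qed.

(** Sylvester's rank inequality: X_1 D and X_1^T have rank at least N - 1, so their product has rank
    at least 2 (N - 1) - N. *)
Lemma rank_grover_sub1 : (0 < #|arc g|)%N -> (#|arc g| = #|T| + M)%N ->
  (#|arc g| <= \rank (grover g - 1%:M)%R + 2)%N.
Proof.
move=> N0 eN; have := grover_sub_sign gS gI (mulr1 1).
rewrite rmorph1 => ->; rewrite (eqmxMfull _ (_ : row_full (flip gS))); last first.
  by rewrite row_full_unit flip_unit.
have := mxrank_mul_min (B 1 *m weights g) (B 1)^T.
rewrite [\rank (_ *m weights g)]mxrankMfree ?row_free_unit ?weights_unit // mxrank_tr.
have := rank_incz N0; move: (\rank _) (\rank _) eN => r1 r2; lia.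
Qed.

Lemma grover_odd_order_2regular (k : nat) :
  (0 < #|arc g|)%N -> odd k -> grover g ^+ k = 1%:M -> forall v, deg g v = 2.
Proof.
move=> N0 ok Uk; have dU := det_1D_odd_order ok Uk.
have U1 : 1%:M + grover g = flip gS *m (B (-1) *m weights g *m (B (-1))^T).
  rewrite -grover_sub_sign // rmorphN1 addrC; congr (_ + _).
  by apply/matrixP => i j; rewrite !mxE; case: (i == j); rewrite ?mulr1n ?mulr0n ?opprK ?oppr0.
have Uunit : 1%:M + grover g \in unitmx.
  by rewrite unitmxE unitfE -normr_eq0 dU expf_neq0.
(* 1 + U factors through dimension n + M; with N = 2 M this gives M <= n. *)
have Mn : (#|arc g| <= #|T| + M)%N.
  rewrite -(mxrank_unit Uunit) U1; apply: leq_trans (mxrankM_maxr _ _) _.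
  by apply: leq_trans (mxrankM_maxl _ _) _; apply: leq_trans (mxrankM_maxr _ _) (rank_leq_row _).
(* K has full column rank, and the invertible 1 + U sends its columns into the span of the M columns
   of L_1. *)
have nM : (#|T| <= M)%N.
  have rK : \rank K = #|T|.
    apply/eqP; rewrite eqn_leq rank_leq_col /=.
    have Du : K^T *m K \in unitmx.
      rewrite head_gram unitmxE unitfE det_diag; apply/prodf_neq0 => v _.
      by rewrite mxE pnatr_eq0 -lt0n deg_gt0.
    by rewrite -{1}(mxrank_unit Du) mxrankM_maxr.
  have UK : (1%:M + grover g) *m K = L 1 *m ((L 1)^T *m K).
    rewrite mulmxA edge_gram ?mulr1 // rmorph1 scale1r !mulmxDl; congr (_ + _).
    rewrite (grover_flip gS) -mulmxA; congr (_ *m _).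
    rewrite mulmxBl mul1mx -(mulmxA _ K^T K) head_gram -mulmxA.
    (* This makes (1 + U) K = K + S (2 K - K) = (1 + S) K. *)
    have -> : dinv g *m diag_mx (\row_v (deg g (enum_val v))%:R) = 2%:M.
      rewrite mulmx_diag -diag_const_mx; congr diag_mx; apply/rowP => v; rewrite !mxE.
      by rewrite divfK // pnatr_eq0 -lt0n deg_gt0.
    by rewrite mul_mx_scalar scaler_nat mulr2n addrK.
  have rUK : \rank (L 1 *m ((L 1)^T *m K)) = \rank K.
    by rewrite -UK eqmxMfull // row_full_unit.
  by rewrite -rK -rUK; apply: leq_trans (mxrankM_maxl _ _) (rank_leq_col _).
have cA := card_arc gS gI.
have eN : #|arc g| = (#|T| + M)%N by lia.
have eM : M = #|T| by lia.
have rU := rank_grover_sub1 N0 eN.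
have dU4 : `|\det (1%:M + grover g)| <= 4.
  rewrite dU (_ : 4 = 2 ^+ 2) // ler_eXn2l ?ltr1n //; lia.
have detU : `|\det (1%:M + grover g)| = `|\det (B (-1) *m weights g *m (B (-1))^T)|.
  rewrite U1 det_mulmx normrM.
  have : `|\det (flip gS)| ^+ 2 = 1.
    by rewrite -normrX expr2 -det_mulmx flipK det1 normr1.
  by move/eqP; rewrite sqrp_eq1 // => /eqP ->; rewrite mul1r.
have := det_congruence_ge (D := weights g) eN N0 (X := incz gS (-1)).
rewrite -normr_eq0 -detU => /(_ _ _).
(* The head contributes 1 and the edge part 1 or -1, so a row sums to 2 or 0. *)
have row_even i : (2 %| \sum_j incz gS (-1) i j)%Z.
  rewrite big_split_ord /=.
  have -> : \sum_(v < #|T|) incz gS (-1) i (lshift M v) = 1.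
    rewrite (bigD1 (enum_rank (t_arc (enum_val i)))) //= big1 => [|v nv].
      by rewrite row_mxEl mxE enum_rankK eqxx addr0.
    rewrite row_mxEl mxE -[t_arc _]enum_rankK (inj_eq enum_val_inj) eq_sym.
    by rewrite (negPf nv).
  under eq_bigr do rewrite row_mxEr.
  rewrite -(enum_valK i); have [j [->|->]] := arc_cases gS gI (enum_val i).
    rewrite (bigD1 j) //= big1 => [|l nl]; rewrite edgez_pos // ?eqxx //.
    by rewrite eq_sym (negPf nl).
  rewrite (bigD1 j) //= big1 => [|l nl]; rewrite edgez_neg // ?eqxx //.
  by rewrite eq_sym (negPf nl) mulr0.
move=> /(_ row_even); rewrite dU expf_neq0 // => /(_ isT); rewrite -dU.
move=> ge4; have {ge4 dU4} := le_trans ge4 dU4.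
rewrite det_weights // -[leRHS]mulr1 ler_pM2l // => prod_le.
have prod_ge : 2 ^+ #|T| <= \prod_v ((deg g v)%:R : rat).
  move: prod_le; rewrite big_split /= prodr_const prodfV.
  rewrite ler_pdivrMr ?mul1r //.
  by apply: prodr_gt0 => v _; rewrite ltr0n deg_gt0.
have [a _] := card_gt0P N0.
have T0 : (0 < #|T|)%N by apply/card_gt0P; exists (o_arc a).
have mean : (\sum_v (deg g v)%:R) / #|T|%:R = 2 :> rat.
  rewrite -natr_sum sum_deg eN eM addnn -mul2n natrM mulfK //.
  by rewrite pnatr_eq0 -lt0n.
(* The AM-GM bound 2^n meets the lower bound [prod_ge]; equality makes all degrees equal to their
   mean. *)
have [prod_le2 prod_eq] := leif_AGM (A := predT) (E := fun v => (deg g v)%:R : rat) (fun v _ => ler0n _ _).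
move: prod_le2 prod_eq; rewrite mean => prod_le2.
have -> : \prod_(v in T) ((deg g v)%:R : rat) = 2 ^+ #|T|.
  by apply/le_anti; rewrite prod_le2.
rewrite eqxx => /esym/'forall_'forall_eqP all_eq v.
apply/eqP; rewrite -(eqr_nat rat) -mean.
under eq_bigr => u _ do rewrite (all_eq u v).
by rewrite sumr_const -[_ *+ #|_|]mulr_natr mulfK // pnatr_eq0 -lt0n.
Qed.

End OddPeriodRegular.

(** * The walk on a 2-regular graph *)

Section TwoRegular.
Variables (T : finType) (g : rel T).
Hypotheses (gS : symmetric g) (gI : irreflexive g) (g2 : forall v, deg g v = 2).

Lemma other_nbr (v u : T) : g v u ->
  exists2 w, w != u & forall x, g v x = (x == u) || (x == w).
Proof.
move=> gvu; have uN : u \in [set w | g v w] by rewrite inE.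
have /cards1P[w wE] : #|[set w | g v w] :\ u| == 1%N.
  by have := cardsD1 u [set w | g v w]; rewrite uN -/(deg g v) g2; lia.
have /setP wE' := wE; exists w.
  by have := wE' w; rewrite !inE eqxx => /andP[].
move=> x; have := wE' x; rewrite !inE => <-.
by case: eqP => //= ->.
Qed.

Lemma next_arc_subproof (a : arc g) :
  exists b : arc g, (o_arc b == t_arc a) && (t_arc b != o_arc a).
Proof.
have [w wa wN] : exists2 w, w != o_arc a & forall x, g (t_arc a) x = (x == o_arc a) || (x == w).
  by apply: other_nbr; rewrite gS arc_adj.
have gw : g (t_arc a, w).1 (t_arc a, w).2 by rewrite /= wN eqxx orbT.
by exists (Sub (t_arc a, w) gw); rewrite /o_arc /t_arc /= eqxx.
Qed.

(** The continuation of the walk without backtracking; degree 2 makes it unique. *)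
Definition next_arc (a : arc g) : arc g := xchoose (next_arc_subproof a).

Lemma o_next a : o_arc (next_arc a) = t_arc a.
Proof. by have /andP[/eqP] := xchooseP (next_arc_subproof a). Qed.

Lemma t_next_neq a : t_arc (next_arc a) != o_arc a.
Proof. by have /andP[_] := xchooseP (next_arc_subproof a). Qed.

Lemma nbr_head a y : g (t_arc a) y = (y == o_arc a) || (y == t_arc (next_arc a)).
Proof.
have [w wa wN] : exists2 w, w != o_arc a & forall x, g (t_arc a) x = (x == o_arc a) || (x == w).
  by apply: other_nbr; rewrite gS arc_adj.
have := wN (t_arc (next_arc a)); rewrite -{1}o_next arc_adj (negPf (t_next_neq a)) /=.
by move=> /esym/eqP ->; apply: wN.
Qed.

Lemma next_arc_unique a b : o_arc b = t_arc a -> t_arc b != o_arc a -> b = next_arc a.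
Proof.
move=> ob tb; have := nbr_head a (t_arc b).
rewrite -ob arc_adj (negPf tb) /= => /esym/eqP tb'.
by apply/eqP; rewrite arc_eqE ob o_next tb' !eqxx.
Qed.

Local Notation rev := (rev_arc gS).

(** Retracing a step: reversal conjugates [next_arc] to its inverse, which yields injectivity. *)
Lemma next_rev_next a : next_arc (rev (next_arc a)) = rev a.
Proof.
apply/esym/next_arc_unique; first by rewrite o_rev t_rev o_next.
by rewrite t_rev o_rev eq_sym t_next_neq.
Qed.

Lemma next_arc_inj : injective next_arc.
Proof.
by move=> a b e; apply: (can_inj (rev_arcK gS)); rewrite -(next_rev_next a) -(next_rev_next b) e.
Qed.

Lemma iter_next_rev m a : iter m next_arc (rev (iter m next_arc a)) = rev a.
Proof. by elim: m a => // m IH a; rewrite iterSr iterS next_rev_next IH. Qed.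

(* Since rev conjugates next to its inverse, rev a = next^m a can be shortened at
   both ends down to m = 0 or m = 1. *)
Lemma rev_arc_notin_orbit m a : rev a != iter m next_arc a.
Proof.
elim/ltn_ind: m a => -[_ a|[_ a|m IH a]]; first exact: rev_arc_neq.
  by rewrite arc_eqE t_rev eq_sym [_ == t_arc _]eq_sym (negPf (t_next_neq a)) andbF.
rewrite -next_rev_next iterS (inj_eq next_arc_inj) iterSr; exact: IH.
Qed.

Lemma same_origin a b : o_arc a = o_arc b -> a = b \/ b = next_arc (rev a).
Proof.
move=> oab; case: (eqVneq (t_arc b) (t_arc a)) => [tab|tba].
  by left; apply/eqP; rewrite arc_eqE oab tab !eqxx.
by right; apply: next_arc_unique; rewrite ?t_rev ?o_rev ?oab.
Qed.

(** The only other arc leaving the origin of b is [next_arc (rev b)]; meeting it later would put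
    [rev b] in the orbit of b. *)
Lemma same_origin_orbit a i j :
  o_arc (iter i next_arc a) = o_arc (iter j next_arc a) ->
  iter i next_arc a = iter j next_arc a.
Proof.
wlog ij : i j / (i <= j)%N => [hw|].
  by case/orP: (leq_total i j) => [/hw //|/hw h /esym/h].
rewrite -(subnK ij) iterD; move: (iter i _ a) (j - i)%N => b m.
case/same_origin => // e; case: m e => // m; rewrite iterS => /next_arc_inj e.
by have := rev_arc_notin_orbit m b; rewrite e eqxx.
Qed.

(** At degree 2 the backtracking entry 2/deg - 1 is 0 and the transmitting entry is 1. *)
Lemma grover_next e f : grover_entry e f = (e == next_arc f)%:R.
Proof.
rewrite /grover_entry g2 divff // subrr [t_arc f == _]eq_sym.
case: eqP => [oe|ne] /=; last first.
  by case: eqP => // ef; case: ne; rewrite ef o_next.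
case: eqP => [te|/eqP te]; last by rewrite -(next_arc_unique oe te) eqxx.
by case: eqP => // ef; have := t_next_neq f; rewrite -ef te eqxx.
Qed.

Lemma grover_expE m i j :
  (grover g ^+ m) i j = (enum_val i == iter m next_arc (enum_val j))%:R.
Proof.
elim: m i j => [|m IH] i j.
  by rewrite expr0 [LHS]mxE /= (inj_eq enum_val_inj).
rewrite exprSr [LHS]mxE (bigD1 (enum_rank (next_arc (enum_val j)))) //= big1 => [|l nl].
  by rewrite IH !mxE grover_next enum_rankK eqxx mulr1 addr0 -iterS iterSr.
rewrite [grover g _ _]mxE grover_next -[next_arc _]enum_rankK (inj_eq enum_val_inj).
by rewrite (negPf nl) mulr0.
Qed.

Lemma grover_exp1P m :
  grover g ^+ m = 1%:M <-> forall a, iter m next_arc a = a.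
Proof.
split=> [/matrixP U1 a|fixm].
  have := U1 (enum_rank a) (enum_rank a).
  by rewrite grover_expE !mxE !enum_rankK eqxx; case: eqP => // /eqP.
apply/matrixP => i j; rewrite grover_expE fixm !mxE (inj_eq enum_val_inj) //.
Qed.

(** * Connected 2-regular graphs are cycles *)

Section Connected.
Hypothesis gC : connected_graph g.
Variable a0 : arc g.

Local Notation p := (order next_arc a0).

Let pos i := o_arc (iter i next_arc a0).

Lemma iter_next_modn m : iter (m %% p)%N next_arc a0 = iter m next_arc a0.
Proof.
rewrite {2}(divn_eq m p) addnC iterD; congr iter.
elim: (m %/ p)%N => //= q IH; rewrite mulSn addnC iterD iter_order //.
exact: next_arc_inj.
Qed.

Lemma pos_inj i j : (i < p)%N -> (j < p)%N -> pos i = pos j -> i = j.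
Proof.
move=> ip jp /same_origin_orbit e.
by rewrite -(findex_iter ip) -(findex_iter jp) e.
Qed.

Lemma pos_modn m : pos (m %% p)%N = pos m.
Proof. by rewrite /pos iter_next_modn. Qed.

Lemma pos_nbr i y : g (pos i) y -> y = pos i.+1 \/ exists2 j, y = pos j & (i = j.+1 %[mod p])%N.
Proof.
have p0 : (0 < p)%N by apply: order_gt0.
(* Going once more round the orbit gives [pos i] a predecessor even when i = 0. *)
rewrite -pos_modn -modnDr pos_modn -(prednK p0) addnS /pos iterS o_next nbr_head.
case/orP => /eqP ->.
  right; exists (i + p.-1)%N => //; by rewrite -addnS prednK // modnDr.
left; rewrite -iterS -addnS prednK // -o_next -iterS -addSn.
by rewrite -/(pos (i.+1 + p)) -pos_modn modnDr pos_modn.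
Qed.

Lemma pos_surj x : exists i, x = pos i.
Proof.
have /connectP[s sP ->] := gC (pos 0) x.
elim: s 0%N sP => [|y s IH] i /=; first by exists i.
by case/andP=> /pos_nbr[->|[j -> _]]; apply: IH.
Qed.

(** By [pos_inj] and [pos_surj], [pos] numbers the vertices modulo p, and by [pos_nbr] neighbours
    are consecutive. *)
Lemma is_cycle_graph_order : is_cycle_graph g p.
Proof.
have p0 : (0 < p)%N by apply: order_gt0.
pose h (i : 'I_p) := pos i.
have h_inj : injective h by move=> i j /(pos_inj (ltn_ord i) (ltn_ord j))/val_inj.
have h_surj x : exists i, h i = x.
  have [i ->] := pos_surj x; exists (Ordinal (ltn_pmod i p0)).
  by rewrite /h /= pos_modn.
have [f fK hK] : bijective h.
  apply: inj_card_bij => //; rewrite -(card_codom h_inj); apply/subset_leq_card.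
  by apply/subsetP => x _; have [i <-] := h_surj x; apply: codom_f.
exists f; split; first by exists h.
move=> x y; rewrite -{1}(hK x) -{1}(hK y); move: (f x) (f y) => i j.
apply/idP/orP => [/pos_nbr[e|[l e il]]|].
- left; rewrite eq_sym; apply/eqP/esym/pos_inj; [exact: ltn_ord|exact: ltn_pmod|by rewrite pos_modn].
- right; have jl : (j = l %[mod p])%N.
    by apply: pos_inj; rewrite ?ltn_pmod // !pos_modn.
  by rewrite -addn1 -modnDml jl modnDml addn1 -il modn_small.
have adj l : g (pos l) (pos l.+1) by rewrite /pos iterS o_next arc_adj.
case=> /eqP e; last rewrite gS; rewrite /h e pos_modn; exact: adj.
Qed.

End Connected.

Lemma card_ge3 (v : T) : (3 <= #|T|)%N.
Proof.
apply: leq_trans (max_card (mem (v |: [set w | g v w]))).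
by rewrite cardsU1 inE gI -/(deg g v) g2.
Qed.

End TwoRegular.

(** * The period of a cycle graph *)

Section CycleGraph.
Variables (T : finType) (g : rel T) (n : nat).
Hypotheses (gS : symmetric g) (gI : irreflexive g) (n3 : (3 <= n)%N).
Variables (f : T -> 'I_n) (h : 'I_n -> T).
Hypotheses (fK : cancel f h) (hK : cancel h f).
Hypothesis gE : forall x y,
  g x y = ((val (f y) == ((f x).+1 %% n)%N) || (val (f x) == ((f y).+1 %% n)%N)).

Lemma cycle_adj x y : g x y = (f y == ordS (f x)) || (f x == ordS (f y)).
Proof. by rewrite gE -!val_eqE. Qed.

Lemma iter_ordS m (i : 'I_n) : val (iter m (@ordS n) i) = ((i + m) %% n)%N.
Proof.
elim: m => [|m IH]; first by rewrite addn0 modn_small.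
by rewrite iterS /= IH -addn1 modnDml addn1 addnS.
Qed.

Lemma iter_ordS_fixed m (i : 'I_n) : iter m (@ordS n) i = i -> (n %| m)%N.
Proof.
move/(congr1 val); rewrite iter_ordS -[RHS](modn_small (ltn_ord i)) => /eqP.
by rewrite -{2}[val i]addn0 eqn_modDl mod0n.
Qed.

Lemma iter_n_ordS (i : 'I_n) : iter n (@ordS n) i = i.
Proof. by apply/val_inj; rewrite iter_ordS modnDr modn_small. Qed.

(** Equality would make two successor steps trivial, so n would divide 2, against [n3]. *)
Lemma ordS_neq_pred (i : 'I_n) : ordS i != ord_pred i.
Proof.
apply/eqP => e; have : iter 2 (@ordS n) i = i by rewrite /= e ord_predK.
by move/iter_ordS_fixed/dvdn_leq; lia.
Qed.

Lemma cycle_deg v : deg g v = 2.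
Proof.
rewrite /deg -(card_imset _ (can_inj fK)).
have -> : f @: [set w | g v w] = [set ordS (f v); ord_pred (f v)].
  apply/setP => i; rewrite -[i]hK mem_imset ?inE; last exact: can_inj fK.
  by rewrite cycle_adj [f v == _]eq_sym (can2_eq (@ordSK n) (@ord_predK n)).
by rewrite cards2 ordS_neq_pred.
Qed.

Local Notation next := (next_arc gS cycle_deg).
Let forward (a : arc g) := f (t_arc a) == ordS (f (o_arc a)).

(** The alternative is a return to the origin of a, excluded by [t_next_neq]. *)
Lemma next_forward a : forward a -> forward (next a).
Proof.
move=> fa; have := arc_adj (next a); rewrite cycle_adj => /orP[//|].
rewrite o_next (eqP fa) (inj_eq (can_inj (@ordSK n))) (inj_eq (can_inj fK)).
by rewrite eq_sym (negPf (t_next_neq _ _ _)).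
Qed.

Lemma iter_next_forward m a : forward a ->
  forward (iter m next a) /\ f (o_arc (iter m next a)) = iter m (@ordS n) (f (o_arc a)).
Proof.
move=> fa; elim: m => //= m [fm <-]; split; first exact: next_forward.
by rewrite o_next; apply/eqP.
Qed.

Lemma iter_n_next_forward a : forward a -> iter n next a = a.
Proof.
move=> fa; have [/eqP ft fo] := iter_next_forward n fa.
rewrite fo iter_n_ordS in ft; rewrite iter_n_ordS in fo.
apply/eqP; rewrite arc_eqE; apply/andP; split; apply/eqP/(can_inj fK) => //.
by rewrite ft; apply/esym/eqP.
Qed.

Lemma iter_n_next a : iter n next a = a.
Proof.
have [fa|nfa] := boolP (forward a); first exact: iter_n_next_forward.
have fra : forward (rev_arc gS a).
  by have := arc_adj a; rewrite cycle_adj -/(forward a) (negPf nfa).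
have iter_inj m : injective (iter m next).
  by elim: m => // m IH x y /next_arc_inj/IH.
(* Both [rev (next^n a)] and the forward arc [rev a] are sent to [rev a] by next^n. *)
apply: (can_inj (rev_arcK gS)); apply: (iter_inj n).
by rewrite iter_next_rev iter_n_next_forward.
Qed.

Lemma cycle_k_periodic : k_periodic g n.
Proof.
have n0 : (0 < n)%N by lia.
split=> //; split=> [|m /andP[m0 mn]].
  by apply/(grover_exp1P gS cycle_deg); apply: iter_n_next.
move/(grover_exp1P gS cycle_deg) => fixm.
(* A forward arc from position 0 is back after m steps only if n divides m. *)
pose i0 := Ordinal n0.
have g01 : g (h i0, h (ordS i0)).1 (h i0, h (ordS i0)).2 by rewrite cycle_adj !hK eqxx.
pose a : arc g := Sub (h i0, h (ordS i0)) g01.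
have fa : forward a by rewrite /forward /a /t_arc /o_arc /= !hK.
have [_] := iter_next_forward m fa; rewrite fixm => /esym/iter_ordS_fixed/dvdn_leq; lia.
Qed.

End CycleGraph.

(** * The equivalence *)

Lemma is_cycle_graph_periodic (n : nat) (T : finType) (g : rel T) :
  (3 <= n)%N -> simple_graph g -> is_cycle_graph g n -> k_periodic g n.
Proof.
move=> n3 [gS gI] [f [[h fK hK] gE]]; exact: (cycle_k_periodic gS n3 fK hK gE).
Qed.

Lemma k_periodic_unique (T : finType) (g : rel T) (k n : nat) :
  k_periodic g k -> k_periodic g n -> k = n.
Proof.
move=> [k0 [gk kmin]] [n0 [gn nmin]]; case: (ltngtP k n) => // lt.
  by case: (nmin k); rewrite ?k0.
by case: (kmin n); rewrite ?n0.
Qed.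

Theorem theorem2p5 (k : nat) (T : finType) (g : rel T) :
  (3 <= k)%N -> odd k -> simple_graph g -> connected_graph g ->
  (k_periodic g k <-> is_cycle_graph g k).
Proof.
move=> k3 ok gSI gC; split=> [gk|]; last exact: is_cycle_graph_periodic.
have [gS gI] := gSI; have [k0 [Uk kmin]] := gk.
have N0 : (0 < #|arc g|)%N.
  (* Without arcs U is the 0 by 0 matrix, already the identity at exponent 1 < k. *)
  rewrite lt0n; apply/eqP => N0; case: (kmin 1%N); first by rewrite andTb; lia.
  by apply/matrixP => i; have := ltn_ord i; rewrite {2}N0.
have g2 := grover_odd_order_2regular gS gI gC N0 ok Uk.
have [a _] := card_gt0P N0.
have cyc := is_cycle_graph_order gS gI g2 gC (a : arc g).
have p3 : (3 <= order (next_arc gS g2) (a : arc g))%N.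
  have [f [bf _]] := cyc; have := bij_eq_card bf; rewrite card_ord => <-.
  exact: (card_ge3 gI g2 (o_arc a)).
(* A cycle of length p has period p, and the period is unique, so p = k. *)
by rewrite (k_periodic_unique gk (is_cycle_graph_periodic p3 gSI cyc)).
Qed.
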